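(* Let $\mathcal{G}$ be a class of graphs that is $\chi$-bounded by an exponential function. Then $\mathcal{G}^*$ is also $\chi$-bounded by an exponential function.
   Context: All graphs are finite and simple, possibly empty; $\omega$ is the clique number and $\chi$ the chromatic number. A class $\mathcal{G}$ is $\chi$-bounded by $f:\mathbb{N}\rightarrow\mathbb{R}$ if for all $G\in\mathcal{G}$ and all (possibly empty) induced subgraphs $H$ of $G$, $\chi(H)\leq f(\omega(H))$. An exponential function here means a function of the form $n\mapsto a\,b^{n}$ with constants $a>0$, $b>1$. Given non-empty graphs $G_1,G_2$ with disjoint vertex sets and $u\in V_{G_1}$, the graph obtained by substituting $G_2$ for $u$ in $G_1$ has vertex set $(V_{G_1}\smallsetminus\{u\})\cup V_{G_2}$, induces $G_1\smallsetminus u$ and $G_2$ on the respective parts, and each $v\in V_{G_1}\smallsetminus\{u\}$ is complete to $V_{G_2}$ if $v$ is adjacent to $u$ and anti-complete to $V_{G_2}$ otherwise. $\mathcal{G}^*$ denotes the closure of $\mathcal{G}$ under taking disjoint unions and substitution. *)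

(* Defs.v *)
From mathcomp Require Import all_boot all_order all_algebra.
From mathcomp Require Import reals.

Set Implicit Arguments.
Unset Strict Implicit.
Unset Printing Implicit Defensive.

Import Order.TTheory GRing.Theory Num.Theory.

Record sgraph := SGraph {
  vertex :> finType;
  adj : rel vertex;
  adj_sym : symmetric adj;
  adj_irrefl : irreflexive adj }.

Definition is_iso (G H : sgraph) (f : G -> H) : Prop :=
  bijective f /\ forall x y : G, adj (f x) (f y) = adj x y.

Definition isomorphic (G H : sgraph) : Prop := exists f : G -> H, is_iso f.

Section Induced.
Variables (G : sgraph) (A : {set G}).

Definition induced_adj : rel {x : G | x \in A} :=
  fun x y => adj (val x) (val y).

Lemma induced_sym : symmetric induced_adj.
Proof. by move=> x y; rewrite /induced_adj adj_sym. Qed.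

Lemma induced_irrefl : irreflexive induced_adj.
Proof. by move=> x; rewrite /induced_adj adj_irrefl. Qed.

Definition induced : sgraph := SGraph induced_sym induced_irrefl.
End Induced.

Definition clique (G : sgraph) (A : {set G}) : bool :=
  [forall x in A, forall y in A, (x != y) ==> adj x y].

Definition omega (G : sgraph) : nat := \max_(A : {set G} | clique A) #|A|.

Definition proper_coloring (G : sgraph) (k : nat) (c : {ffun G -> 'I_k}) : bool :=
  [forall x, forall y, adj x y ==> (c x != c y)].

Definition colorable (G : sgraph) (k : nat) : bool :=
  [exists c : {ffun G -> 'I_k}, proper_coloring c].

Lemma colorable_ex (G : sgraph) : exists k, colorable G k.
Proof.
exists #|G|; apply/existsP; exists [ffun x => enum_rank x].
apply/forallP=> x; apply/forallP=> y; apply/implyP=> xy.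
rewrite !ffunE; apply: contraTneq xy => /enum_rank_inj ->.
by rewrite adj_irrefl.
Qed.

Definition chi (G : sgraph) : nat := ex_minn (colorable_ex G).

Section DisjointUnion.
Variables G1 G2 : sgraph.

Definition dunion_adj : rel (G1 + G2)%type := fun x y =>
  match x, y with
  | inl x1, inl y1 => adj x1 y1
  | inr x2, inr y2 => adj x2 y2
  | _, _ => false
  end.

Lemma dunion_sym : symmetric dunion_adj.
Proof. by case=> x [] y //=; rewrite adj_sym. Qed.

Lemma dunion_irrefl : irreflexive dunion_adj.
Proof. by case=> x /=; rewrite adj_irrefl. Qed.

Definition dunion : sgraph := SGraph dunion_sym dunion_irrefl.
End DisjointUnion.

Section Substitution.
Variables (G1 : sgraph) (u : G1) (G2 : sgraph).

Definition substitute_adj : rel ({x : G1 | x != u} + G2)%type := fun x y =>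
  match x, y with
  | inl x1, inl y1 => adj (val x1) (val y1)
  | inl x1, inr _ => adj (val x1) u
  | inr _, inl y1 => adj (val y1) u
  | inr x2, inr y2 => adj x2 y2
  end.

Lemma substitute_sym : symmetric substitute_adj.
Proof. by case=> x [] y //=; rewrite adj_sym. Qed.

Lemma substitute_irrefl : irreflexive substitute_adj.
Proof. by case=> x /=; rewrite adj_irrefl. Qed.

Definition substitute : sgraph := SGraph substitute_sym substitute_irrefl.
End Substitution.

Definition graph_class := sgraph -> Prop.

(* Vertex sets are types, so the disjointness of the operands is realized by
   sum types, and the resulting graphs are taken up to isomorphism
   ([star_iso]).  In [star_substitute] the graph G1 is non-empty since
   it contains u. *)
Inductive star_closure (C : graph_class) : graph_class :=
| star_base (G : sgraph) : C G -> star_closure C G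
| star_iso (G H : sgraph) : isomorphic G H -> star_closure C G -> star_closure C H
| star_dunion (G1 G2 : sgraph) :
    star_closure C G1 -> star_closure C G2 -> star_closure C (dunion G1 G2)
| star_substitute (G1 : sgraph) (u : G1) (G2 : sgraph) :
    0 < #|G2| -> star_closure C G1 -> star_closure C G2 ->
    star_closure C (substitute u G2).

Local Open Scope ring_scope.

Definition chi_bounded_by (R : realType) (C : graph_class) (f : nat -> R) : Prop :=
  forall G : sgraph, C G ->
  forall A : {set G}, (chi (induced A))%:R <= f (omega (induced A)).

Definition exponential (R : realType) (f : nat -> R) : Prop :=
  exists a b : R, [/\ 0 < a, 1 < b & forall n : nat, f n = a * b ^+ n].

(* Main.v *)
Require Import Defs.
From mathcomp Require Import all_boot all_order all_algebra.
From mathcomp Require Import boolp reals.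
From mathcomp Require Import zify.

(** Working with [chi <= K ^ (omega + 1)] for [C], one shows
    [chi <= B ^ omega] for the closure, with [B = (2 K^2)^2 + 1].
    Call [G] composable if replacing its vertices by graphs satisfying this
    bound hereditarily always yields a graph satisfying it.  Composability is
    preserved by disjoint unions and substitutions, so the point is that the
    members of [C] are composable.  Let [n] be the clique number of the
    composed graph and weigh each vertex of [G] by the clique number of its
    fiber.  Fibers of weight [n] are anticomplete to everything else, so they
    can be coloured separately.  The vertices of weight in (n/2, n) form a
    stable set, hence their fibers share [B ^ (n-1)] colours.  The vertices of
    a given weight [j <= n/2] induce a subgraph with clique number at most
    [n/j], hence their fibers need at most [K ^ (n+1) * B ^ (n/2)] colours.
    The total is at most [B ^ n]. *)

Set Implicit Arguments.
Unset Strict Implicit.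
Unset Printing Implicit Defensive.

(** * Colourings and cliques of vertex subsets *)

Definition set_colorable (D : sgraph) (T : {set D}) (k : nat) : Prop :=
  exists c : D -> nat, (forall x, x \in T -> c x < k) /\
    (forall x y, x \in T -> y \in T -> adj x y -> c x != c y).

(** Like [set_colorable], this lives on subsets of a fixed graph, so that passing to smaller subsets
    never nests [induced]. *)
Definition set_omega (D : sgraph) (T : {set D}) : nat :=
  \max_(A : {set D} | clique A && (A \subset T)) #|A|.

Lemma cliqueP (D : sgraph) (A : {set D}) :
  reflect (forall x y, x \in A -> y \in A -> x != y -> adj x y) (clique A).
Proof.
apply: (iffP forall_inP) => [h x y xA yA xy|h x xA].
  by have /forall_inP/(_ y yA)/implyP := h x xA; apply.
by apply/forall_inP=> y yA; apply/implyP; apply: h.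
Qed.

Section SetColorings.
Variable D : sgraph.
Implicit Types (S T A : {set D}) (k m : nat).

Lemma clique1 (x : D) : clique [set x].
Proof. by apply/cliqueP=> a b /set1P-> /set1P->; rewrite eqxx. Qed.

Lemma set_omega_sup T A : clique A -> A \subset T -> #|A| <= set_omega T.
Proof.
by move=> cA sA; apply: (leq_bigmax_cond (F := fun A : {set D} => #|A|)); rewrite cA.
Qed.

Lemma set_omega_attained T :
  exists A : {set D}, [/\ clique A, A \subset T & #|A| = set_omega T].
Proof.
have c0 : 0 < #|[pred A : {set D} | clique A && (A \subset T)]|.
  apply/card_gt0P; exists set0; rewrite inE sub0set andbT.
  by apply/cliqueP=> x y; rewrite inE.
have [A] := eq_bigmax_cond (fun A : {set D} => #|A|) c0.
by rewrite inE => /andP[cA sA] e; exists A.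
Qed.

Lemma set_omega_gt0 T x : x \in T -> 0 < set_omega T.
Proof.
by move=> xT; rewrite -(cards1 x); apply: set_omega_sup (clique1 x) _; rewrite sub1set.
Qed.

Lemma set_omegaS S T : S \subset T -> set_omega S <= set_omega T.
Proof.
move=> sST; have [A [cA sA <-]] := set_omega_attained S.
exact: set_omega_sup cA (subset_trans sA sST).
Qed.

Lemma set_colorable_le S T k m :
  S \subset T -> k <= m -> set_colorable T k -> set_colorable S m.
Proof.
move=> /subsetP sST km [c [ck cp]]; exists c; split=> [x /sST/ck h|x y /sST xT /sST].
  exact: leq_trans h km.
exact: cp.
Qed.

Lemma set_colorable_empty T k : (forall x, x \notin T) -> set_colorable T k.
Proof. by move=> T0; exists (fun=> 0); split=> [x|x y] xT; have := T0 x; rewrite xT. Qed.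

(** No edge joins two classes of [q], so all classes reuse the same [k] colours. *)
Lemma set_colorable_glue (L : eqType) (q : D -> L) T k :
  (forall x y, x \in T -> y \in T -> adj x y -> q x = q y) ->
  (forall l, set_colorable [set x in T | q x == l] k) -> set_colorable T k.
Proof.
move=> qadj /choice[c cP]; exists (fun x => c (q x) x); split=> [x xT|x y xT yT xy].
  by apply: (cP (q x)).1; rewrite inE xT eqxx.
have e := qadj _ _ xT yT xy; rewrite -e.
by apply: (cP (q x)).2; rewrite ?inE ?xT ?yT -?e ?eqxx.
Qed.

(** A vertex receives the pair of its label and its colour within the class, encoded as
    [q x * k + c (q x) x]. *)
Lemma set_colorable_label (q : D -> nat) T m k :
  (forall x, x \in T -> q x < m) ->
  (forall i, set_colorable [set x in T | q x == i] k) -> set_colorable T (m * k).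
Proof.
move=> qm /choice[c cP].
have ck x : x \in T -> c (q x) x < k.
  by move=> xT; apply: (cP (q x)).1; rewrite inE xT eqxx.
exists (fun x => q x * k + c (q x) x); split=> [x xT|x y xT yT xy].
  have := ck x xT; have := qm x xT; nia.
have [e|ne] := eqVneq (q x) (q y); last first.
  have := ck x xT; have := ck y yT; move: ne; nia.
rewrite -e eqn_add2l.
by apply: (cP (q x)).2; rewrite ?inE ?xT ?yT ?e ?eqxx.
Qed.

Lemma set_colorable_split (P : pred D) T k m :
  set_colorable [set x in T | P x] k -> set_colorable [set x in T | ~~ P x] m ->
  set_colorable T (k + m).
Proof.
move=> [c [ck cp]] [d [dm dp]].
exists (fun x => if P x then c x else k + d x).
have ck' x : x \in T -> P x -> c x < k by move=> xT Px; apply: ck; rewrite inE xT.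
have dm' x : x \in T -> P x = false -> d x < m.
  by move=> xT Px; apply: dm; rewrite inE xT Px.
split=> [x xT|x y xT yT xy].
  by case: ifPn => [/(ck' _ xT)|/negbTE/(dm' _ xT)]; lia.
case Px: (P x); case Py: (P y).
- by apply: cp; rewrite ?inE ?xT ?yT ?Px ?Py.
- have := ck' x xT Px; lia.
- have := ck' y yT Py; lia.
- by rewrite eqn_add2l; apply: dp; rewrite ?inE ?xT ?yT ?Px ?Py.
Qed.

Lemma set_omega_induced A : omega (induced A) = set_omega A.
Proof.
apply/eqP; rewrite eqn_leq; apply/andP; split.
  apply/bigmax_leqP=> Q /cliqueP cQ.
  rewrite -(card_imset Q val_inj); apply: set_omega_sup.
    apply/cliqueP=> _ _ /imsetP[x xQ ->] /imsetP[y yQ ->] xy.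
    by apply: (cQ x y xQ yQ); apply: contra_neq xy => ->.
  by apply/subsetP=> _ /imsetP[x _ ->]; apply: valP.
have [Q [/cliqueP cQ /subsetP sQ <-]] := set_omega_attained A.
have -> : Q = val @: [set x : induced A | val x \in Q].
  apply/setP=> x; apply/idP/imsetP=> [xQ|[y]]; last by rewrite inE => ? ->.
  by exists (Sub x (sQ x xQ)); rewrite ?inE ?SubK.
rewrite card_imset; last exact: val_inj.
apply: (leq_bigmax_cond (F := fun A : {set _} => #|A|)).
apply/cliqueP=> x y; rewrite !inE => xQ yQ xy; exact: cQ.
Qed.

Lemma chi_induced_le A k : set_colorable A k -> chi (induced A) <= k.
Proof.
move=> [c [ck cp]]; rewrite /chi; case: ex_minnP => m _; apply.
apply/existsP; exists [ffun x => Ordinal (ck (val x) (valP x))].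
apply/forallP=> x; apply/forallP=> y; apply/implyP=> xy; rewrite !ffunE -val_eqE /=.
exact: cp (valP x) (valP y) xy.
Qed.

Lemma set_colorable_chi A : set_colorable A (chi (induced A)).
Proof.
rewrite /chi; case: ex_minnP => m /existsP[c /forallP cP] _.
exists (fun x => if insub x is Some z then nat_of_ord (c z) else 0); split=> [x xA|x y xA yA xy].
  by rewrite (insubT (fun x => x \in A) xA).
rewrite (insubT (fun x => x \in A) xA) (insubT (fun x => x \in A) yA).
by have /forallP/(_ (Sub y yA))/implyP := cP (Sub x xA); apply.
Qed.

End SetColorings.

(** * Composable graphs and their closure properties *)

Section Composition.
Variable B : nat.

Definition omega_colorable (D : sgraph) (T : {set D}) : Prop :=
  set_colorable T (B ^ set_omega T).

(* [S] is seen as the graph obtained from [G] by replacing each vertex [v]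
   by the fiber of [p] over [Some v]; [None] is only used outside [S]. *)
Definition modular (G D : sgraph) (S : {set D}) (p : D -> option G) : Prop :=
  (forall x, x \in S -> p x) /\
  (forall x y u v, x \in S -> y \in S -> p x = Some u -> p y = Some v ->
     u != v -> adj x y = adj u v).

(** The hypothesis covers every subset [T] of a fiber, which makes it hereditary; nested
    compositions rely on this. *)
Definition composable (G : sgraph) : Prop :=
  forall (D : sgraph) (S : {set D}) (p : D -> option G), modular S p ->
  (forall (v : G) (T : {set D}), T \subset S -> (forall x, x \in T -> p x = Some v) ->
     omega_colorable T) ->
  omega_colorable S.

Lemma composable_iso (G H : sgraph) : isomorphic G H -> composable G -> composable H.
Proof.
move=> [f [[g fK gK] fadj]] cG D S p [pS padj] pT.
apply: (cG D S (fun x => omap g (p x))).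
  split=> [x /pS|x y u v xS yS]; first by case: (p x).
  case px: (p x) => [a|] //= -[<-]; case py: (p y) => [b|] //= -[<-] gab.
  rewrite -fadj !gK; apply: padj px py _ => //.
  by apply: contra_neq gab => ->.
move=> v T sTS Tv; apply: (pT (f v) T sTS) => x /Tv.
by case: (p x) => //= a [<-]; rewrite gK.
Qed.

(** The parts of [S] over [G1] and over [G2] are anticomplete, so they share their colours. *)
Lemma composable_dunion (G1 G2 : sgraph) : 0 < B ->
  composable G1 -> composable G2 -> composable (dunion G1 G2).
Proof.
move=> B0 c1 c2 D S p [pS padj] pT.
pose q x : bool := if p x is Some (inl _) then true else false.
apply: (@set_colorable_glue _ _ q).
  move=> x y xS yS xy; rewrite /q; have := pS x xS; have := pS y yS.
  case px: (p x) => [[a|a]|] //; case py: (p y) => [[b|b]|] // _ _.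
    by move: xy; rewrite (padj _ _ _ _ xS yS px py).
  by move: xy; rewrite (padj _ _ _ _ xS yS px py).
have sub b : [set x in S | q x == b] \subset S.
  by apply/subsetP=> x; rewrite inE => /andP[].
move=> b; apply: (set_colorable_le (subxx _)).
  exact: leq_pexp2l B0 (set_omegaS (sub b)).
case: b (sub b) => [] sS.
- apply: (c1 D _ (fun x => if p x is Some (inl v) then Some v else None)).
    split=> [x|x y u v]; rewrite !inE /q.
      by move=> /andP[_]; case: (p x) => [[]|].
    move=> /andP[xS _] /andP[yS _].
    case px: (p x) => [[a|a]|] //= -[<-]; case py: (p y) => [[b|b]|] //= -[<-] ab.
    by rewrite (padj _ _ _ _ xS yS px py).
  move=> v T sT Tv; apply: (pT (inl v) T (subset_trans sT sS)) => x /Tv.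
  by case: (p x) => [[a|a]|] // -[<-].
- apply: (c2 D _ (fun x => if p x is Some (inr v) then Some v else None)).
    split=> [x|x y u v]; rewrite !inE /q.
      by move=> /andP[/pS]; case: (p x) => [[]|].
    move=> /andP[xS _] /andP[yS _].
    case px: (p x) => [[a|a]|] //= -[<-]; case py: (p y) => [[b|b]|] //= -[<-] ab.
    by rewrite (padj _ _ _ _ xS yS px py).
  move=> v T sT Tv; apply: (pT (inr v) T (subset_trans sT sS)) => x /Tv.
  by case: (p x) => [[a|a]|] // -[<-].
Qed.

(** Merging all fibers over [G2] into one fiber over [u] gives a composition of [G1]. The merged
    fiber is a composition of [G2], so [c2] supplies what [c1] requires of it. *)
Lemma composable_substitute (G1 : sgraph) (u : G1) (G2 : sgraph) :
  composable G1 -> composable G2 -> composable (substitute u G2).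
Proof.
move=> c1 c2 D S p [pS padj] pT.
apply: (c1 D S (fun x => if p x is Some z then
  Some (if z is inl v then val v else u) else None)).
  split=> [x /pS|x y a b xS yS]; first by case: (p x).
  case px: (p x) => [[s|s]|] //= -[<-]; case py: (p y) => [[t|t]|] //= -[<-] ab;
    [| | |by rewrite eqxx in ab];
    by rewrite (padj _ _ _ _ xS yS px py) //= adj_sym.
move=> v T sT Tv; have [vu|vu] := eqVneq v u; last first.
  apply: (pT (inl (exist _ v vu)) T sT) => x /Tv.
  case: (p x) => [[a|a]|] // -[e]; last by case/negP: (vu); rewrite e.
  by congr (Some (inl _)); apply: val_inj.
have Tr x : x \in T -> exists a, p x = Some (inr a).
  move=> /Tv; case: (p x) => [[a|a]|] //; last by exists a.
  by move=> [e]; have := valP a; rewrite /= e vu eqxx.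
apply: (c2 D T (fun x => if p x is Some (inr a) then Some a else None)).
  split=> [x /Tr[a ->] //|x y a b xT yT].
  have [[s px] [t py]] := (Tr x xT, Tr y yT).
  rewrite px py => -[<-] [<-] st.
  by rewrite (padj _ _ _ _ (subsetP sT _ xT) (subsetP sT _ yT) px py).
move=> a T' sT' T'a; apply: (pT (inr a) T' (subset_trans sT' sT)) => x xT'.
have [b px] := Tr x (subsetP sT' _ xT').
by have := T'a x xT'; rewrite px => -[->].
Qed.

(** The graph is the composition of itself with one-vertex fibers, each of which needs one
    colour. *)
Lemma composable_omega_colorable (G : sgraph) (A : {set G}) : 0 < B ->
  composable G -> omega_colorable A.
Proof.
move=> B0 cG; apply: (cG G A Some); first by split=> // x y u v _ _ [->] [->].
move=> v T sT Tv; exists (fun=> 0); split=> [x _|x y xT yT].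
  by rewrite expn_gt0 B0.
by have [[->] [->]] := (Tv x xT, Tv y yT); rewrite adj_irrefl.
Qed.

End Composition.

(** * Weights of fibers and cliques of the composed graph *)

Section Fibers.
Variables (G D : sgraph) (S : {set D}) (p : D -> option G).
Hypothesis modp : modular S p.

Definition fiber (o : option G) : {set D} := [set x in S | p x == o].

Lemma fiberS o : fiber o \subset S.
Proof. by apply/subsetP=> x; rewrite inE => /andP[]. Qed.

(** Maximum cliques of the fibers over [Q] are pairwise disjoint and complete to each other, so
    their union is a clique of [S]. *)
Lemma clique_fiber_weight (Q : {set G}) : clique Q ->
  \sum_(v in Q) set_omega (fiber (Some v)) <= set_omega S.
Proof.
move=> /cliqueP cQ.
have /choice[A AP] := fun v => set_omega_attained (fiber (Some v)).
have sA v x : x \in A v -> (x \in S) /\ p x = Some v.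
  have [_ /subsetP s _] := AP v.
  by move=> /s; rewrite inE => /andP[xS /eqP].
(* Emptying [F] off [Q] lets the union range over all vertices of [G]. *)
pose F v := if v \in Q then A v else set0.
have FP v x : x \in F v -> v \in Q /\ x \in A v.
  by rewrite /F; case: ifP; rewrite ?inE.
have disF i j : i != j -> [disjoint F i & F j].
  move=> ij; apply/pred0P=> x /=; apply/negP=> /andP[/FP[_ /sA[_ pi]] /FP[_ /sA[_ pj]]].
  by move: ij; rewrite pi in pj; case: pj => ->; rewrite eqxx.
have <- : #|\bigcup_v F v| = \sum_(v in Q) set_omega (fiber (Some v)).
  rewrite -sum1_card partition_disjoint_bigcup //= big_mkcond [RHS]big_mkcond /=.
  apply: eq_bigr => v _; rewrite sum1_card /F; case: ifP => _.
    by have [_ _ ->] := AP v.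
  by rewrite cards0.
apply: set_omega_sup.
  apply/cliqueP=> x y /bigcupP[u _ /FP[uQ xu]] /bigcupP[v _ /FP[vQ yv]] xy.
  have [[xS px] [yS py]] := (sA _ _ xu, sA _ _ yv).
  have [e|uv] := eqVneq u v; last by rewrite (modp.2 _ _ _ _ xS yS px py) ?cQ.
  by have [/cliqueP c _ _] := AP u; apply: c => //; rewrite e.
by apply/subsetP=> x /bigcupP[v _ /FP[_ /sA[]]].
Qed.

Lemma adj_fiber_weight x y : x \in S -> y \in S -> adj x y -> p x != p y ->
  set_omega (fiber (p x)) + set_omega (fiber (p y)) <= set_omega S.
Proof.
move=> xS yS xy; have := modp.1 _ xS; have := modp.1 _ yS.
case px: (p x) => [u|] //; case py: (p y) => [v|] // _ _ uv.
have {}uv : u != v by apply: contra_neq uv => ->.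
have auv : adj u v by rewrite -(modp.2 _ _ _ _ xS yS px py).
have := @clique_fiber_weight [set u; v].
rewrite big_setU1 ?big_set1 ?inE //=; apply; apply/cliqueP=> a b.
by move=> /set2P[]-> /set2P[]->; rewrite ?eqxx // adj_sym.
Qed.

End Fibers.

(** * Graphs with exponentially bounded colourings are composable *)

Lemma composition_bound K n : 0 < K -> 1 < n ->
  ((2 * K ^ 2) ^ 2).+1 ^ n.-1 +
    n./2 * (K ^ n.+1 * ((2 * K ^ 2) ^ 2).+1 ^ n./2)
  <= ((2 * K ^ 2) ^ 2).+1 ^ n.
Proof.
move=> K0 n1; set X := 2 * K ^ 2; set B := (X ^ 2).+1.
have X0 : 0 < X by rewrite /X muln_gt0 expn_gt0 K0.
(* Here [n./2 <= 2 ^ n] and [n.+1 <= 2 * n]. *)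
have hX : n./2 * K ^ n.+1 <= X ^ n.
  rewrite /X expnMn -expnM; apply: leq_mul.
    by apply: leq_trans (ltnW (ltn_expl n (ltnSn 1))); lia.
  by apply: leq_pexp2l => //; lia.
(* Since [n <= 2 * (n.-1 - n./2).+1], this follows from [X ^ 2 <= B], with one factor [X ^ 2] kept
   apart. *)
have hX2 : X ^ n <= X ^ 2 * B ^ (n.-1 - n./2).
  apply: (@leq_trans (X ^ (2 * (n.-1 - n./2).+1))).
    by apply: leq_pexp2l => //; lia.
  rewrite expnM expnS leq_mul //.
  by case: (n.-1 - n./2) => // m; rewrite leq_exp2r ?leqnSn.
have -> : B ^ n = B ^ n.-1 + X ^ 2 * B ^ n.-1.
  by case: n n1 {hX hX2} => // n _; rewrite expnS mulSn.
rewrite leq_add2l mulnA; apply: leq_trans (leq_mul (leq_trans hX hX2) (leqnn _)) _.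
by rewrite -mulnA -expnD subnK //; lia.
Qed.

Lemma chi_bounded_composable K (G : sgraph) : 0 < K ->
  (forall A : {set G}, set_colorable A (K ^ (set_omega A).+1)) ->
  composable ((2 * K ^ 2) ^ 2).+1 G.
Proof.
move=> K0 colG D S p modp pT; set B := _.+1 in pT *.
pose n := set_omega S; pose w x := set_omega (fiber S p (p x)).
have colF (T : {set D}) k v : T \subset S -> (forall x, x \in T -> p x = Some v) ->
    (forall x, x \in T -> w x <= k) -> set_colorable T (B ^ k).
  move=> sT Tv wk; have [->|[x xT]] := set_0Vmem T.
    by apply: set_colorable_empty => x; rewrite inE.
  apply: set_colorable_le (subxx T) _ (pT v T sT Tv).
  apply: leq_pexp2l => //; apply: leq_trans (wk x xT).
  apply: set_omegaS; apply/subsetP=> y yT.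
  by rewrite inE (subsetP sT) // !Tv /=.
have wS x : w x <= n by apply: set_omegaS; apply: fiberS.
have w0 x : x \in S -> 0 < w x.
  by move=> xS; apply: (@set_omega_gt0 _ _ x); rewrite inE xS eqxx.
(* An edge between two fibers has positive weights with sum at most [n], so neither weight is [n].
   Each fiber of weight [n] is thus a class of its own, and [None] labels all the rest. *)
apply: (@set_colorable_glue _ _ (fun x => if w x == n then p x else None)).
  move=> x y xS yS xy; have [e|ne] := eqVneq (p x) (p y); first by rewrite /w e.
  have := adj_fiber_weight modp xS yS xy ne; rewrite -/(w x) -/(w y) -/n.
  have := w0 _ xS; have := w0 _ yS => ? ? ?.
  by rewrite !ltn_eqF //; lia.
case=> [v|].
  apply: (colF _ _ v) => [|x|x _]; last exact: wS.
    by apply/subsetP=> x; rewrite inE => /andP[].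
  by rewrite inE => /andP[_]; case: ifP => // _ /eqP.
set T := [set x in S | _].
have TS x : x \in T -> x \in S by rewrite inE => /andP[].
have Tn x : x \in T -> w x < n.
  rewrite inE => /andP[xS].
  have [_ /eqP e|ne _] := eqVneq (w x) n; last by rewrite ltn_neqAle ne wS.
  by have := modp.1 _ xS; rewrite e.
(* Weights in [T] lie strictly between 0 and [n]. *)
have [n1|n1] := leqP n 1.
  apply: set_colorable_empty => x; apply/negP=> xT.
  by have := Tn x xT; have := w0 x (TS x xT); lia.
apply: set_colorable_le (subxx _) (composition_bound K0 n1) _.
(* When no edge of [U] joins two fibers, the fibers share the colours given by [colF]. *)
have colp (U : {set D}) k : U \subset S ->
    (forall x y, x \in U -> y \in U -> adj x y -> p x = p y) ->
    (forall x, x \in U -> w x <= k) -> set_colorable U (B ^ k).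
  move=> /subsetP sU Uadj Uk; apply: (@set_colorable_glue _ _ p) => // -[v|].
    apply: (colF _ _ v) => [|x|x]; last by rewrite inE => /andP[/Uk].
      by apply/subsetP=> x; rewrite inE => /andP[/sU].
    by rewrite inE => /andP[_ /eqP].
  apply: set_colorable_empty => x; apply/negP.
  by rewrite inE => /andP[/sU/(modp.1)] + /eqP e; rewrite e.
(* Adjacent vertices of weight above [n./2] lie in one fiber, as otherwise their weights would sum
   to more than [n]. *)
apply: (@set_colorable_split _ (fun x => n./2 < w x)).
  apply: colp => [|x y|x].
  - by apply/subsetP=> x; rewrite inE => /andP[/TS].
  - rewrite inE => /andP[/TS xS wx]; rewrite inE => /andP[/TS yS wy] xy; apply/eqP/negPn/negP=> ne.
    have := adj_fiber_weight modp xS yS xy ne.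
    by rewrite -/(w x) -/(w y) -/n; lia.
  - by rewrite inE => /andP[/Tn + _]; lia.
(* The remaining weights run from 1 to [n./2]; the shift turns them into labels below [n./2]. *)
apply: (@set_colorable_label _ (fun x => (w x).-1)).
  by move=> x; rewrite inE => /andP[/TS/w0]; lia.
move=> j; pose W := [set v | set_omega (fiber S p (Some v)) == j.+1].
(* Every fiber over [W] weighs at least 1, so a clique of [W] has at most as many vertices as its
   total weight. *)
have omW : set_omega W <= n.
  have [Q [cQ /subsetP sQ <-]] := set_omega_attained W.
  apply: leq_trans (clique_fiber_weight modp cQ).
  rewrite -sum1_card; apply: leq_sum => v /sQ.
  by rewrite inE => /eqP->.
have [d [dK dp]] := colG W.
have UP x : x \in [set x in [set x in T | ~~ (n./2 < w x)] | (w x).-1 == j] ->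
    [/\ x \in S, w x <= n./2 & exists2 v, p x = Some v & v \in W].
  move=> xU; have [[xT wx] wj] : (x \in T /\ w x <= n./2) /\ (w x).-1 = j.
    by move: xU; rewrite 2!inE -leqNgt => /andP[/andP[? ?] /eqP].
  split=> //; first exact: TS.
  have := modp.1 _ (TS _ xT); case px: (p x) => [v|] // _; exists v => //.
  by rewrite inE -px -/(w x); have := w0 x (TS _ xT); lia.
(* The colouring [d] of [W] is pulled back along [p]; within one colour, no edge joins two different
   fibers. *)
apply: (@set_colorable_label _ (fun x => if p x is Some v then d v else 0)).
  move=> x /UP[_ _ [v -> vW]]; apply: leq_trans (dK v vW) _.
  exact: leq_pexp2l.
move=> i; apply: colp => [|x y|x].
- by apply/subsetP=> x; rewrite inE => /andP[/UP[]].
- rewrite inE => /andP[/UP[xS _ [u px uW]] /eqP]; rewrite px => du.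
  rewrite inE => /andP[/UP[yS _ [v py vW]] /eqP]; rewrite py => dv xy.
  have [-> //|uv] := eqVneq u v.
  rewrite (modp.2 _ _ _ _ xS yS px py uv) in xy.
  by have := dp u v uW vW xy; rewrite du dv eqxx.
- by rewrite inE => /andP[/UP[]].
Qed.

(** * From composable graphs to the closure *)

Lemma star_closure_composable (C : graph_class) (B : nat) (G : sgraph) : 0 < B ->
  (forall H, C H -> composable B H) -> star_closure C G -> composable B G.
Proof.
move=> B0 cC; elim=> {G} [G /cC //|G H iso _|G1 G2 _ c1 _ c2|G1 u G2 _ _ c1 _ c2].
- exact: composable_iso.
- exact: composable_dunion.
- exact: composable_substitute.
Qed.

Import Order.TTheory GRing.Theory Num.Theory.
Local Open Scope ring_scope.

Theorem theorem2p6 (R : realType) (C : graph_class) :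
  (exists f : nat -> R, exponential f /\ chi_bounded_by C f) ->
  exists g : nat -> R, exponential g /\ chi_bounded_by (star_closure C) g.
Proof.
move=> [f [[a [b [a0 b1 fE]]] fC]].
(* A natural number above both [a] and [b] gives [a * b ^+ n <= K ^ n.+1]; the extra factor absorbs
   [a]. *)
pose K := (Num.bound a + Num.bound b)%N.
have b0 : 0 < b := lt_trans ltr01 b1.
have aK : a <= K%:R.
  by rewrite natrD; apply: (le_trans (ltW (archi_boundP (ltW a0)))); rewrite lerDl ler0n.
have bK : b <= K%:R.
  by rewrite natrD; apply: (le_trans (ltW (archi_boundP (ltW b0)))); rewrite lerDr ler0n.
have K0 : (0 < K)%N by rewrite -(ltr_nat R); apply: lt_le_trans aK.
pose B := ((2 * K ^ 2) ^ 2).+1%N.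
have cC H : C H -> composable B H.
  move=> CH; apply: chi_bounded_composable => // A.
  apply: set_colorable_le (subxx _) _ (set_colorable_chi A).
  rewrite -(ler_nat R) -set_omega_induced; apply: le_trans (fC H CH A) _.
  rewrite fE natrX exprS; apply: ler_pM => //; rewrite ?exprn_ge0 ?(ltW a0) ?(ltW b0) //.
  by apply: lerXn2r; rewrite ?nnegrE ?ler0n // ltW.
exists (fun n => 1 * B%:R ^+ n); split.
  exists 1, B%:R; split=> //.
  by rewrite ltr1n /B ltnS !expn_gt0 muln_gt0 expn_gt0 K0.
move=> G sG A; rewrite mul1r -natrX ler_nat set_omega_induced.
apply: chi_induced_le; apply: composable_omega_colorable => //.
exact: star_closure_composable sG.
Qed.
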